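(* Let $\mathbb{V}$ be a finite-dimensional vector space over a field $\mathbb{F}$ with basis $\{\alpha_1,\alpha_2,\ldots,\alpha_n\}$, and let $\Gamma(\mathbb{V}_\alpha)$ be its non-zero component graph with respect to this basis. Then $\Gamma(\mathbb{V}_\alpha)$ is connected and $\mathrm{diam}(\Gamma(\mathbb{V}_\alpha))=2$.
   Context: Let $\theta$ be the null vector of $\mathbb{V}$ and $n=\dim_{\mathbb{F}}(\mathbb{V})$. Every $\mathbf{a}\in\mathbb{V}$ is written uniquely as $\mathbf{a}=a_1\alpha_1+a_2\alpha_2+\cdots+a_n\alpha_n$ with $a_i\in\mathbb{F}$. The non-zero component graph $\Gamma(\mathbb{V}_\alpha)$ with respect to the basis $\{\alpha_1,\ldots,\alpha_n\}$ is the graph with vertex set $\mathbb{V}\setminus\{\theta\}$ (the vertex set of a graph is by definition non-empty) in which vertices $\mathbf{a}$ and $\mathbf{b}$ are adjacent if there is at least one index $i$ with $a_i\neq 0$ and $b_i\neq 0$. A graph is connected if any pair of vertices is joined by a path. The distance $d(u,v)$ is the length of a shortest path joining $u$ and $v$ if one exists, and $\infty$ otherwise. The diameter of a graph is the largest distance $d(u,v)$ over all pairs of vertices $u,v$ if it exists, and $\infty$ otherwise.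
   Formalization: Connectedness is shown for every n ≥ 1 (non-empty vertex set), but diam = 2 only for n ≥ 2: when n = 1 any two distinct non-zero vectors are adjacent, so the diameter is at most 1 and the claim fails. *)

(* Defs.v *)
From mathcomp Require Import all_boot all_order all_algebra.
From mathcomp Require Import boolp.

Set Implicit Arguments.
Unset Strict Implicit.
Unset Printing Implicit Defensive.

Import GRing.Theory.
Local Open Scope ring_scope.

(* A graph is given by its vertex type T, possibly infinite, and its adjacency
   relation e.  A path is a sequence of pairwise distinct vertices
   u :: p; its length is the number size p of its edges. *)
Definition is_path (T : eqType) (e : rel T) (u v : T) (p : seq T) : bool :=
  [&& path e u p, last u p == v & uniq (u :: p)].

Definition connected_graph (T : eqType) (e : rel T) : Prop :=
  forall u v : T, exists p : seq T, is_path e u v p.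

Definition has_path_of_length (T : eqType) (e : rel T) (u v : T) (k : nat) :
    Prop :=
  exists2 p : seq T, is_path e u v p & size p = k.

(* Distances and diameters take values in option nat, None being infinity. *)
Definition distance (T : eqType) (e : rel T) (u v : T) : option nat :=
  if pselect (exists k, `[< has_path_of_length e u v k >]) is left h
  then Some (ex_minn h) else None.

Definition is_largest_distance (T : eqType) (e : rel T) (d : nat) : Prop :=
  (exists u v : T, distance e u v = Some d) /\
  (forall u v : T, exists2 k, distance e u v = Some k & (k <= d)%N).

(* If some distance is infinite, no natural number is the largest distance,
   and the diameter is infinite as it should be. *)
Definition diameter (T : eqType) (e : rel T) : option nat :=
  if pselect (exists d, is_largest_distance e d) is left h
  then Some (projT1 (cid h)) else None.

Definition nonzero_vector (F : fieldType) (V : vectType F) : eqType :=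
  {v : V | v != 0}.

(* When alpha is a basis of V, coord alpha i a is the coefficient of
   alpha`_i in the unique expansion of a.  The relation is reflexive, but the
   loops never occur in a path. *)
Definition nonzero_component_adj (F : fieldType) (V : vectType F) (n : nat)
    (alpha : n.-tuple V) : rel (nonzero_vector V) :=
  fun a b => [exists i : 'I_n,
    (coord alpha i (val a) != 0) && (coord alpha i (val b) != 0)].

(* Main.v *)
Require Import Defs.
From mathcomp Require Import all_boot all_order all_algebra.
From mathcomp Require Import boolp.

Import GRing.Theory.

(** Vertices with a common nonzero component are adjacent; otherwise, if [u] has
    a nonzero [i]-th and [v] a nonzero [j]-th component, then
    [alpha_i + alpha_j] is adjacent to both, so all distances are at most 2.
    Two distinct basis vectors share no component, so the bound is attained. *)

Lemma distance_le_size (T : eqType) (e : rel T) (u v : T) (p : seq T) :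
  is_path e u v p -> exists2 k, distance e u v = Some k & k <= size p.
Proof.
move=> path_p; have len_p: `[< has_path_of_length e u v (size p) >].
  by apply/asboolP; exists p.
rewrite /distance; case: pselect => [h|[]]; last by exists (size p).
by exists (ex_minn h) => //; case: ex_minnP => k _; apply.
Qed.

Lemma distance_has_path (T : eqType) (e : rel T) (u v : T) (k : nat) :
  distance e u v = Some k -> has_path_of_length e u v k.
Proof.
rewrite /distance; case: pselect => // h [<-].
by case: ex_minnP => m /asboolP.
Qed.

(** [diameter] picks its value by choice, so uniqueness has to be shown: of two largest distances,
    each is attained by some pair and hence bounded by the other. *)
Lemma diameter_largest (T : eqType) (e : rel T) (d : nat) :
  is_largest_distance e d -> diameter e = Some d.
Proof.
move=> d_max; rewrite /diameter; case: pselect => [h|[]]; last by exists d.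
case: (cid h) => d' /= [[u' [v' d'E]] d'_max].
case: d_max => [[u [v dE]] d_max].
have [k] := d_max u' v'; rewrite d'E => -[<-] le_d'd.
have [k'] := d'_max u v; rewrite dE => -[<-] le_dd'.
by congr Some; apply/eqP; rewrite eqn_leq le_d'd.
Qed.

Section NonzeroComponentGraph.

Context {F : fieldType} {V : vectType F} {n : nat} {alpha : n.-tuple V}.
Hypothesis basis_alpha : basis_of {:V}%VS alpha.

Lemma nonzero_component (a : nonzero_vector V) :
  exists i, coord alpha i (val a) != 0%R.
Proof.
apply/existsP; apply: contraT; rewrite negb_exists => /forallP a0.
case/negP: (valP a); apply/eqP.
rewrite (coord_basis basis_alpha (memvf (val a))) big1 // => i _.
by move: (a0 i); rewrite negbK => /eqP ->; rewrite scale0r.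
Qed.

Lemma coord_basis_vector (i j : 'I_n) : coord alpha i alpha`_j = ((i == j)%:R)%R.
Proof. by rewrite (coord_free _ _ (basis_free basis_alpha)) eq_sym. Qed.

Lemma exists_short_path (u v : nonzero_vector V) :
  exists2 p, is_path (nonzero_component_adj alpha) u v p & size p <= 2.
Proof.
(* Equal vertices need the empty path: the loop [[:: v]] would repeat a vertex. *)
have [<-|neq_uv] := eqVneq u v; first by exists [::]; rewrite /is_path /= ?eqxx.
have [adj_uv|nadj_uv] := boolP (nonzero_component_adj alpha u v).
  by exists [:: v]; rewrite /is_path //= adj_uv eqxx inE neq_uv.
have [[i ui0] [j vj0]] := (nonzero_component u, nonzero_component v).
(* A common index would make [u] and [v] adjacent. Distinctness gives [w] the components 1 at [i]
   and [j], so [w] is nonzero even in characteristic 2. *)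
have neq_ij: i != j.
  by apply: contraNneq nadj_uv => eq_ij; apply/existsP; exists j; rewrite -{1}eq_ij ui0.
set w := (alpha`_i + alpha`_j)%R.
have wi: coord alpha i w = 1%R.
  by rewrite linearD /= !coord_basis_vector eqxx (negPf neq_ij) addr0.
have wj: coord alpha j w = 1%R.
  by rewrite linearD /= !coord_basis_vector eqxx eq_sym (negPf neq_ij) add0r.
have w0: w != 0%R by apply: contra_eq_neq wi => ->; rewrite linear0 eq_sym oner_neq0.
pose x : nonzero_vector V := exist _ w w0.
have adj_ux: nonzero_component_adj alpha u x.
  by apply/existsP; exists i; rewrite ui0 /= wi oner_neq0.
have adj_xv: nonzero_component_adj alpha x v.
  by apply/existsP; exists j; rewrite vj0 /= wj oner_neq0.
(* The path has no repetition: if [x] were [u] or [v], one of its two edges would join [u] to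
   [v]. *)
exists [:: x; v] => //; rewrite /is_path /= adj_ux adj_xv eqxx !inE.
rewrite (negPf neq_uv) orbF !andbT /=; apply/andP; split.
  by apply: contraNneq nadj_uv => ->.
by apply: contraNneq nadj_uv => <-.
Qed.

Lemma distance_le2 (u v : nonzero_vector V) :
  exists2 k, distance (nonzero_component_adj alpha) u v = Some k & k <= 2.
Proof.
have [p path_p size_p] := exists_short_path u v.
have [k dE le_k] := distance_le_size _ _ _ _ _ path_p.
by exists k; rewrite ?(leq_trans le_k).
Qed.

Lemma basis_vector_neq0 (i : 'I_n) : (alpha`_i != 0)%R.
Proof.
apply: contra_eq_neq (coord_basis_vector i i) => ->.
by rewrite linear0 eqxx eq_sym oner_neq0.
Qed.

Definition basis_vertex (i : 'I_n) : nonzero_vector V :=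
  exist _ (alpha`_i)%R (basis_vector_neq0 i).

(** The only nonzero component of [alpha_i] is the [i]-th. The diagonal case is a loop, which serves
    below to separate distinct basis vertices. *)
Lemma adj_basis_vertex (i j : 'I_n) :
  nonzero_component_adj alpha (basis_vertex i) (basis_vertex j) = (i == j).
Proof.
apply/existsP/eqP => [[k]|<-]; last first.
  by exists i; rewrite /= coord_basis_vector eqxx oner_neq0.
rewrite /= !coord_basis_vector.
by case: (k =P i) => [<-|]; case: (k =P j) => [<-|]; rewrite ?eqxx ?andbF.
Qed.

Lemma distance_basis_vertex (i j : 'I_n) : i != j ->
  distance (nonzero_component_adj alpha) (basis_vertex i) (basis_vertex j)
  = Some 2.
Proof.
move=> neq_ij.
have [k dE le_k2] := distance_le2 (basis_vertex i) (basis_vertex j).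
have [p /and3P[path_p last_p _] size_p] := distance_has_path _ _ _ _ _ dE.
rewrite dE; congr Some; apply/eqP; rewrite eqn_leq le_k2 -size_p.
(* Only lengths 0 and 1 remain to be excluded. An empty path identifies the two vertices, and the
   loop at one of them then gives [i == j]; a single edge gives [i == j] directly. *)
case: p path_p last_p {size_p} => [_|x [|//]] /=.
  by move=> /eqP eq_ij; move: (adj_basis_vertex i j);
     rewrite -eq_ij adj_basis_vertex eqxx (negPf neq_ij).
by rewrite andbT => adj_ix /eqP eq_x; move: adj_ix;
   rewrite eq_x adj_basis_vertex (negPf neq_ij).
Qed.

End NonzeroComponentGraph.

(** Positive dimension makes the vertex set non-empty. The diameter needs dimension at least 2: on a
    line any two nonzero vectors are adjacent, so no distance exceeds 1. *)
Theorem theorem4p1 (F : fieldType) (V : vectType F) (n : nat)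
    (alpha : n.-tuple V) (basis_alpha : basis_of {:V}%VS alpha)
    (n_gt0 : (0 < n)%N) :
  connected_graph (nonzero_component_adj alpha) /\
  ((1 < n)%N -> diameter (nonzero_component_adj alpha) = Some 2%N).
Proof.
split=> [u v|n_gt1].
  by have [p path_p _] := exists_short_path basis_alpha u v; exists p.
apply: diameter_largest; split; last exact: distance_le2.
exists (basis_vertex basis_alpha (Ordinal n_gt0)).
exists (basis_vertex basis_alpha (Ordinal n_gt1)).
exact: distance_basis_vertex.
Qed.
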